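(* Let $\delta>0$ and $\alpha\ge1$. The $\alpha$-approximate price of anarchy of any $\delta$-share bandwidth allocation game is at most $\alpha+1$. For every $\varepsilon>0$, there is a $\delta$-share bandwidth allocation game with an $\alpha$-approximate price of anarchy of $\alpha+1-\varepsilon$.
   Context: A bandwidth allocation game (BAG) is a tuple $(\mathcal{N},\mathcal{R},(b_r)_{r\in\mathcal{R}},(\mathcal{S}_i)_{i\in\mathcal{N}})$ with a set of players $\mathcal{N}=\{1,\dots,n\}$, a set of resources $\mathcal{R}=\{r_1,\dots,r_m\}$, a capacity $b_r>0$ for each resource $r$, and for each player $i$ a finite nonempty strategy space $\mathcal{S}_i\subset\mathbb{R}_{\ge 0}^m$. A strategy $s_i=(s_i(r_1),\dots,s_i(r_m))\in\mathcal{S}_i$ has demand $s_i(r)$ on resource $r$. A strategy profile is ${\sf s}=(s_1,\dots,s_n)\in\mathcal{S}=\mathcal{S}_1\times\dots\times\mathcal{S}_n$. The utility of player $i$ from resource $r$ is $u_{i,r}({\sf s})=\min\left(s_i(r),\frac{b_r\, s_i(r)}{\sum_{j\in\mathcal{N}}s_j(r)}\right)$ (equal to $0$ if $s_i(r)=0$), and her total utility is $u_i({\sf s})=\sum_{r\in\mathcal{R}}u_{i,r}({\sf s})$. For $\delta>0$ the game is a $\delta$-share BAG if $s_i(r)\le\delta b_r$ for every player $i$, every $s_i\in\mathcal{S}_i$ and every resource $r$. $({\sf s}_{-i},s_i')$ denotes the profile obtained from ${\sf s}$ by replacing $i$'s strategy with $s_i'$. For $\alpha\ge1$, a profile ${\sf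 s}$ is an $\alpha$-approximate pure Nash equilibrium if $\alpha\cdot u_i({\sf s})\ge u_i({\sf s}_{-i},s_i')$ for all $i\in\mathcal{N}$ and $s_i'\in\mathcal{S}_i$. The social welfare of ${\sf s}$ is $u({\sf s})=\sum_{i\in\mathcal{N}}u_i({\sf s})$, and $opt$ is a profile maximizing $u$ over $\mathcal{S}$. If $\mathcal{S}^\alpha\subseteq\mathcal{S}$ is the set of $\alpha$-approximate pure Nash equilibria, the $\alpha$-approximate price of anarchy of the game is $\max_{{\sf s}\in\mathcal{S}^\alpha}\frac{u(opt)}{u({\sf s})}$ (which presupposes that the game has an $\alpha$-approximate pure Nash equilibrium).
   Formalization: A price of anarchy equal to α+1−ε is claimed only for ε ≤ α; for ε > α, where that value is below 1 and so impossible, the claim is only that some δ-share game has price of anarchy at least α+1−ε. *)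

(* Defs.v *)
From HB Require Import structures.
From mathcomp Require Import all_boot all_order all_algebra.
From mathcomp Require Import finmap.
From mathcomp Require Import all_classical all_reals all_analysis.

Set Implicit Arguments.
Unset Strict Implicit.
Unset Printing Implicit Defensive.

Import Order.TTheory GRing.Theory Num.Theory.

Local Open Scope classical_set_scope.
Local Open Scope ring_scope.

Record bag (R : realType) (n m : nat) := Bag {
  capacity : 'I_m -> R ;
  strategies : 'I_n -> {fset 'rV[R]_m} ;
  capacity_gt0 : forall r, 0 < capacity r ;
  strategies_neq0 : forall i, strategies i != fset0 ;
  demand_ge0 : forall i (x : 'rV[R]_m) r, x \in strategies i -> 0 <= x ord0 r
}.

(* Profiles are arbitrary families of demand vectors, with [s i ord0 r] the
   demand of player i on resource r; feasibility is membership in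
   [profiles G]. *)
Definition profile (R : realType) (n m : nat) := 'I_n -> 'rV[R]_m.

Section BandwidthAllocation.
Variables (R : realType) (n m : nat) (G : bag R n m).
Implicit Types (s : profile R n m) (i : 'I_n) (r : 'I_m).

Definition profiles : set (profile R n m) :=
  [set s | forall i, s i \in strategies G i].

(* If [s i ord0 r = 0] this is 0 also when the total demand on r is 0, since
   the numerator vanishes and division is total. *)
Definition resource_utility s i r : R :=
  Num.min (s i ord0 r)
          (capacity G r * s i ord0 r / \sum_(j < n) s j ord0 r).

Definition utility s i : R := \sum_(r < m) resource_utility s i r.

Definition welfare s : R := \sum_(i < n) utility s i.

Definition delta_share (delta : R) : Prop :=
  forall i (x : 'rV[R]_m) r,
    x \in strategies G i -> x ord0 r <= delta * capacity G r.

Definition deviate s i (x : 'rV[R]_m) : profile R n m :=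
  fun j => if j == i then x else s j.

Definition approx_nash (alpha : R) : set (profile R n m) :=
  [set s | profiles s /\
    forall i (x : 'rV[R]_m), x \in strategies G i ->
      utility (deviate s i x) i <= alpha * utility s i].

Definition optimal : set (profile R n m) :=
  [set o | profiles o /\ forall s, profiles s -> welfare s <= welfare o].

(* [p] is the maximum of u(opt)/u(s) over the alpha-approximate equilibria s.
   The ratio is taken in the extended reals, where c / 0 = +oo for c > 0 and
   0 / 0 = 0: an equilibrium of welfare 0 makes the price of anarchy infinite
   unless every profile has welfare 0.  No [p] satisfies this predicate if the
   game has no alpha-approximate equilibrium. *)
Definition approx_poa (alpha : R) (p : \bar R) : Prop :=
  exists2 o, optimal o &
    let ratios := [set ((welfare o)%:E / (welfare s)%:E)%E
                  | s in approx_nash alpha] in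
    ratios p /\ ubound ratios p.

Lemma approx_poa_unique (alpha : R) (p q : \bar R) :
  approx_poa alpha p -> approx_poa alpha q -> p = q.
Proof.
move=> [w [wS wmax] [pr pub]] [w' [wS' wmax'] [qr qub]].
have E : welfare w = welfare w' by apply/le_anti; rewrite wmax' ?wmax.
by rewrite E in pr pub; apply/le_anti; rewrite qub ?pub.
Qed.

Lemma finite_max (d : Order.disp_t) (T : orderType d) (f : profile R n m -> T)
    (A : set (profile R n m)) : A `<=` profiles -> A !=set0 ->
  exists2 s, A s & forall t, A t -> (f t <= f s)%O.
Proof.
move=> AS [s0 As0].
pose P := {dffun forall i : 'I_n, strategies G i}.
pose v (a : P) : profile R n m := fun i => val (a i).
have vP s : profiles s -> exists a, v a = s.
  move=> sS; exists (finfun (fun i => [` sS i]%fset) : P).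
  by apply/funext => i; rewrite /v ffunE.
have [a0 va0] := vP _ (AS _ As0).
have Pa0 : `[< A (v a0) >] by apply/asboolP; rewrite va0.
have [a /asboolP Aa amax] :=
  @Order.TotalTheory.arg_maxP d T P a0 (fun a => `[< A (v a) >])
    (fun a => f (v a)) Pa0.
exists (v a) => // t At; have [b vb] := vP _ (AS _ At).
by rewrite -vb; apply: amax; apply/asboolP; rewrite vb.
Qed.

Lemma approx_poa_exists (alpha : R) :
  approx_nash alpha !=set0 -> exists p, approx_poa alpha p.
Proof.
move=> [s sA].
have [w wS wmax] := finite_max welfare (@subset_refl _ profiles)
  (ex_intro _ s (proj1 sA)).
have [t tA tmax] := @finite_max _ (\bar R)
  (fun s => ((welfare w)%:E / (welfare s)%:E)%E) (approx_nash alpha)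
  (fun s h => proj1 h) (ex_intro _ s sA).
exists ((welfare w)%:E / (welfare t)%:E)%E; exists w => //; split.
  by exists t.
by move=> _ [u uA <-]; apply: tmax.
Qed.

End BandwidthAllocation.

(* Main.v *)
Require Import Defs.
From HB Require Import structures.
From mathcomp Require Import all_boot all_order all_algebra.
From mathcomp Require Import finmap.
From mathcomp Require Import all_classical all_reals all_analysis.
From mathcomp Require Import ring lra.

(* Upper bound: on a resource of capacity b with total load T < b, a player
   deviating to demand y obtains at least min(y, b - T) there.  Summed over
   the players and the resources, the deviations from an equilibrium s to the
   strategies of o are worth at least u(o) - u(s), while the equilibrium
   condition bounds them by alpha * u(s).

   Lower bound: n players share a resource of capacity 1, and each chooses
   between a demand delta on it and the pair of demands 1/n on it and a/n on
   an otherwise unused resource, where a = alpha - eps.  As n * delta >= 1 the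
   shared resource is always full, so welfares lie between 1 and 1 + a.  If all
   players demand delta, the shared resource is so overloaded when n is large
   that a deviation gains at most eps/n on it; this profile is then an
   alpha-approximate equilibrium of welfare 1. *)

Set Implicit Arguments.
Unset Strict Implicit.
Unset Printing Implicit Defensive.

Import Order.TTheory GRing.Theory Num.Theory.

Local Open Scope classical_set_scope.
Local Open Scope ring_scope.

(** Either one term exceeds [c] and alone contributes [c] on the right, or no term is truncated.
    This turns bounds for single deviators into one in terms of the total load of [o]. *)
Lemma min_sum_le (R : realDomainType) (I : finType) (F : I -> R) (c : R) :
  0 <= c -> (forall i, 0 <= F i) ->
  Num.min (\sum_i F i) c <= \sum_i Num.min (F i) c.
Proof.
move=> c0 F0.
have [[i ltc]|all_le] := pselect (exists i, c < F i).
  rewrite ge_min; apply/orP; right; rewrite (bigD1 i) //= min_r ?(ltW ltc) //.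
  by rewrite lerDl sumr_ge0 // => j _; rewrite le_min F0.
rewrite ge_min; apply/orP; left; apply: ler_sum => i _.
by rewrite le_min lexx leNgt; apply/negP => ltc; apply: all_le; exists i.
Qed.

(** * Loads, welfare and the upper bound *)

Section Welfare.
Variables (R : realType) (n m : nat) (G : bag R n m).
Implicit Types (s o : profile R n m) (i : 'I_n) (r : 'I_m) (x : 'rV[R]_m).

Definition load s r : R := \sum_(j < n) s j ord0 r.

Lemma profile_ge0 s i r : profiles G s -> 0 <= s i ord0 r.
Proof. by move=> sG; apply: demand_ge0 (sG i). Qed.

Lemma load_ge0 s r : profiles G s -> 0 <= load s r.
Proof. by move=> sG; apply: sumr_ge0 => i _; apply: profile_ge0. Qed.

Lemma deviate_profiles s i x :
  profiles G s -> x \in strategies G i -> profiles G (deviate s i x).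
Proof. by move=> sG xG j; rewrite /deviate; case: eqP => // ->. Qed.

Lemma load_deviate s i x r :
  load (deviate s i x) r = load s r - s i ord0 r + x ord0 r.
Proof.
rewrite /load (bigD1 i) //= [in RHS](bigD1 i) //= /deviate eqxx.
rewrite (eq_bigr (fun j => s j ord0 r)); last by move=> j /negbTE ->.
by ring.
Qed.

(** All players on a resource are served at one common rate, so utilities there can be summed. At
    load 0 the rate is 0 by the convention for division, and so is every demand. *)
Lemma resource_utilityE s i r : profiles G s ->
  resource_utility G s i r = s i ord0 r * Num.min 1 (capacity G r / load s r).
Proof.
move=> sG; rewrite minr_pMr ?profile_ge0 // mulr1.
by rewrite /resource_utility mulrA [capacity G r * _]mulrC.
Qed.

Lemma sum_resource_utility s r : profiles G s ->
  \sum_(i < n) resource_utility G s i r = Num.min (load s r) (capacity G r).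
Proof.
move=> sG; under eq_bigr do rewrite resource_utilityE //.
rewrite -mulr_suml -/(load s r); have b0 := capacity_gt0 G r.
have [T0|T0] := eqVneq (load s r) 0.
  by rewrite T0 mul0r min_l // ltW.
by rewrite minr_pMr ?load_ge0 // mulr1 mulrCA divff ?mulr1.
Qed.

Lemma welfareE s : profiles G s ->
  welfare G s = \sum_(r < m) Num.min (load s r) (capacity G r).
Proof.
move=> sG; rewrite /welfare /utility exchange_big.
by apply: eq_bigr => r _; apply: sum_resource_utility.
Qed.

Lemma welfare_ge0 s : profiles G s -> 0 <= welfare G s.
Proof.
move=> sG; rewrite welfareE //; apply: sumr_ge0 => r _.
by rewrite le_min load_ge0 // ltW // capacity_gt0.
Qed.

Lemma resource_utility_deviate_ge s i x r :
  profiles G s -> x \in strategies G i -> load s r < capacity G r ->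
  Num.min (x ord0 r) (capacity G r - load s r)
    <= resource_utility G (deviate s i x) i r.
Proof.
move=> sG xG ltTb; rewrite /resource_utility -/(load _ r) load_deviate.
rewrite {1}/deviate {1}/deviate eqxx.
have x0 := demand_ge0 r xG; have s0 := profile_ge0 i r sG.
have sT : s i ord0 r <= load s r.
  rewrite /load (bigD1 i) //= lerDl sumr_ge0 // => j _; exact: profile_ge0.
move: (load s r) (s i ord0 r) (x ord0 r) (capacity G r) ltTb x0 s0 sT.
move=> T t y b ltTb y0 t0 tT.
rewrite le_min ge_min lexx /=.
have [yz|yn0] := eqVneq y 0.
  by rewrite yz mulr0 mul0r ge_min lexx.
have yp : 0 < y by rewrite lt_def yn0.
have D0 : 0 < T - t + y by lra.
(* If [T + y <= b], the new load [T - t + y] fits into the capacity and the deviator receives all of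
   [y]. Otherwise the share [b * y / (T - t + y)] is at least [b - T]. *)
have [le_yb|/ltW lt_by] := leP (T + y) b.
  rewrite ge_min ler_pdivlMr // mulrC ler_pM2r //.
  by rewrite (_ : T - t + y <= b) //; lra.
rewrite ge_min !ler_pdivlMr //; apply/orP; right.
(* These two products make up the slack once the denominator is cleared. *)
have h1 : 0 <= T * (T + y - b) by apply: mulr_ge0; lra.
have h2 : 0 <= t * (b - T) by apply: mulr_ge0; lra.
have -> : b * y = (b - T) * (T - t + y) + (T * (T + y - b) + t * (b - T)).
  by ring.
by rewrite lerDl addr_ge0.
Qed.

Lemma welfare_le_deviations s o : profiles G s -> profiles G o ->
  welfare G o <= welfare G s + \sum_(i < n) utility G (deviate s i (o i)) i.
Proof.
move=> sG oG; rewrite !welfareE // /utility exchange_big -big_split /=.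
apply: ler_sum => r _; have b0 := capacity_gt0 G r.
have [ltTb|lebT] := ltP (load s r) (capacity G r).
  have T0 := load_ge0 r sG.
  have h : Num.min (load o r) (capacity G r - load s r)
      <= \sum_(i < n) resource_utility G (deviate s i (o i)) i r.
    apply: le_trans (min_sum_le _ _) _; first by rewrite subr_ge0 ltW.
      by move=> i; apply: profile_ge0.
    by apply: ler_sum => i _; apply: resource_utility_deviate_ge.
  move: h; rewrite ge_min => /orP[h|h].
    by rewrite ge_min (le_trans h) // lerDr.
  by rewrite ge_min -(lerBlDl (capacity G r)) h orbT.
(* On a full resource [s] already collects the whole capacity, the most that [o] can collect; the
   deviations only have to be worth at least 0. *)
rewrite ge_min lerDl sumr_ge0 ?orbT // => i _.
rewrite resource_utilityE; last exact: deviate_profiles.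
apply: mulr_ge0; first by apply: profile_ge0; apply: deviate_profiles.
rewrite le_min ler01 divr_ge0 ?(ltW b0) // load_ge0 //.
exact: deviate_profiles.
Qed.

Lemma welfare_approx_nash (alpha : R) s o :
  approx_nash G alpha s -> profiles G o ->
  welfare G o <= (alpha + 1) * welfare G s.
Proof.
move=> [sG sN] oG; apply: le_trans (welfare_le_deviations sG oG) _.
rewrite mulrDl mul1r addrC lerD2r mulr_sumr.
by apply: ler_sum => i _; apply: sN.
Qed.

Lemma approx_poa_le (alpha : R) (p : \bar R) : 0 <= alpha ->
  approx_poa G alpha p -> (p <= (alpha + 1)%:E)%E.
Proof.
move=> alpha0 [w [wG _] [[s sN <-] _]].
have le_ws := welfare_approx_nash sN wG; have sG := proj1 sN.
(* An equilibrium of welfare 0 forces the optimum to be 0 as well, and the ratio 0 / 0 counts as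
   0. *)
have [s0|sn0] := eqVneq (welfare G s) 0.
  have -> : welfare G w = 0.
    by apply/le_anti; rewrite welfare_ge0 // andbT -(mulr0 (alpha + 1)) -s0.
  by rewrite mul0e lee_fin; lra.
rewrite inver (negbTE sn0) -EFinM lee_fin ler_pdivrMr //.
by rewrite lt_def sn0 welfare_ge0.
Qed.

End Welfare.

(** * The game for the lower bound, with [N.+1] players *)

Section TightGame.
Variables (R : realType) (N : nat) (delta a : R).
Hypotheses (delta_gt0 : 0 < delta) (a_ge0 : 0 <= a).
Hypothesis delta_ge : N.+1%:R^-1 <= delta.

Definition congesting : 'rV[R]_2 := \row_j (if j == ord0 then delta else 0).

Definition spreading : 'rV[R]_2 :=
  \row_j (if j == ord0 then N.+1%:R^-1 else a / N.+1%:R).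

(** The capacity [a + 1] exceeds the largest possible load [a] and stays positive for [a = 0]. *)
Definition tight_capacity (j : 'I_2) : R := if j == ord0 then 1 else a + 1.

Definition tight_strategies (i : 'I_N.+1) : {fset 'rV[R]_2} :=
  [fset congesting; spreading]%fset.

Let invn_gt0 : 0 < N.+1%:R^-1 :> R.
Proof. by rewrite invr_gt0 ltr0n. Qed.

Lemma tight_capacity_gt0 r : 0 < tight_capacity r.
Proof. by rewrite /tight_capacity; case: ifP => _ //; rewrite ltr_wpDl. Qed.

Lemma tight_strategies_neq0 i : tight_strategies i != fset0.
Proof. by apply/fset0Pn; exists congesting; rewrite !inE eqxx. Qed.

Lemma tight_demand_ge0 i (x : 'rV[R]_2) r :
  x \in tight_strategies i -> 0 <= x ord0 r.
Proof.
rewrite !inE => /orP[] /eqP ->; rewrite mxE; case: ifP => _ //;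
  first exact: ltW.
by rewrite mulr_ge0 // ltW.
Qed.

Definition tight_game : bag R N.+1 2 :=
  Bag tight_capacity_gt0 tight_strategies_neq0 tight_demand_ge0.

Lemma tight_game_delta_share : delta_share tight_game delta.
Proof.
move=> i x r; rewrite !inE /= /tight_capacity => /orP[] /eqP ->.
  rewrite mxE; case: ifP => _; first by rewrite mulr1.
  by rewrite mulr_ge0 ?addr_ge0 // ltW.
rewrite mxE; case: ifP => _; first by rewrite mulr1.
by rewrite mulrC ler_pM ?(ltW invn_gt0) // lerDl.
Qed.

Lemma load0_ge1 s : profiles tight_game s -> 1 <= load s ord0.
Proof.
move=> sG; have <- : \sum_(j < N.+1) N.+1%:R^-1 = 1 :> R.
  by rewrite sumr_const card_ord -[LHS]mulr_natr mulVf // pnatr_eq0.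
apply: ler_sum => j _; have := sG j; rewrite !inE => /orP[] /eqP ->.
  by rewrite mxE eqxx.
by rewrite mxE eqxx.
Qed.

Lemma load1_le s : profiles tight_game s -> load s ord_max <= a.
Proof.
move=> sG; have -> : a = \sum_(j < N.+1) a / N.+1%:R.
  by rewrite sumr_const card_ord -[RHS]mulr_natr divfK // pnatr_eq0.
apply: ler_sum => j _; have := sG j; rewrite !inE => /orP[] /eqP ->.
  by rewrite mxE /= mulr_ge0 // ltW.
by rewrite mxE.
Qed.

(** The shared resource is always full and yields exactly 1, while the other is never overloaded and
    yields its load. *)
Lemma welfare_tight s : profiles tight_game s ->
  welfare tight_game s = 1 + load s ord_max.
Proof.
move=> sG; rewrite welfareE // big_ord_recl big_ord1 /=.
have -> : lift ord0 ord0 = ord_max :> 'I_2 by apply: val_inj.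
rewrite /tight_capacity /= min_r ?load0_ge1 // min_l //.
by apply: le_trans (load1_le sG) _; rewrite lerDl.
Qed.

Lemma profiles_congesting : profiles tight_game (fun=> congesting).
Proof. by move=> i; rewrite !inE eqxx. Qed.

Lemma profiles_spreading : profiles tight_game (fun=> spreading).
Proof. by move=> i; rewrite !inE eqxx orbT. Qed.

Lemma welfare_congesting : welfare tight_game (fun=> congesting) = 1.
Proof.
rewrite welfare_tight; last exact: profiles_congesting.
by rewrite /load big1 ?addr0 // => i _; rewrite mxE.
Qed.

Lemma welfare_spreading : welfare tight_game (fun=> spreading) = 1 + a.
Proof.
rewrite welfare_tight; last exact: profiles_spreading.
rewrite /load; under eq_bigr do rewrite mxE /=.
by rewrite sumr_const card_ord -[X in _ + X]mulr_natr divfK // pnatr_eq0.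
Qed.

Lemma optimal_spreading : optimal tight_game (fun=> spreading).
Proof.
split=> [|s sG]; first exact: profiles_spreading.
by rewrite welfare_spreading welfare_tight // lerD2l load1_le.
Qed.

Lemma utility_congesting i :
  utility tight_game (fun=> congesting) i = N.+1%:R^-1.
Proof.
rewrite /utility big_ord_recl big_ord1 /resource_utility.
rewrite !sumr_const card_ord !mxE /= /tight_capacity /= mulr0 mul0r minxx addr0.
(* The equal share [N.+1%:R^-1] is the minimum by [delta_ge]. *)
by rewrite mul1r -[delta *+ _]mulr_natr invfM mulVKf ?gt_eqF // min_r.
Qed.

(** The other [N] players keep a load of [N%:R * delta] on the shared resource, which bounds the
    deviator's rate there by its inverse. *)
Lemma utility_deviate_spreading i : (0 < N)%N ->
  utility tight_game (deviate (fun=> congesting) i spreading) i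
    <= (a + (N%:R * delta)^-1) / N.+1%:R.
Proof.
move=> N0; rewrite /utility big_ord_recl big_ord1 /resource_utility.
rewrite addrC [leRHS]mulrDl; apply: lerD.
  by rewrite ge_min {1}/deviate eqxx mxE /= lexx.
rewrite ge_min; apply/orP; right.
rewrite -/(load _ ord0) load_deviate /deviate eqxx /load sumr_const card_ord.
rewrite !mxE /= /tight_capacity /= mul1r mulrC ler_pM2r //.
have -> : delta *+ N.+1 - delta = N%:R * delta by rewrite mulrS mulr_natl; ring.
have Nd0 : 0 < N%:R * delta by rewrite mulr_gt0 // ltr0n.
by rewrite lef_pV2 ?posrE ?addr_gt0 // lerDl ltW.
Qed.

Lemma approx_nash_congesting (alpha : R) :
  1 <= alpha -> (0 < N)%N -> a + (N%:R * delta)^-1 <= alpha ->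
  approx_nash tight_game alpha (fun=> congesting).
Proof.
move=> alpha1 N0 le_alpha; split=> [|i x]; first exact: profiles_congesting.
rewrite utility_congesting !inE => /orP[] /eqP ->; last first.
  by apply: le_trans (utility_deviate_spreading _ N0) _; rewrite ler_pM2r.
have -> : deviate (fun=> congesting) i congesting = fun=> congesting.
  by apply/funext => j; rewrite /deviate; case: ifP.
by rewrite utility_congesting ler_peMl // ltW.
Qed.

Lemma approx_poa_tight (alpha : R) :
  1 <= alpha -> (0 < N)%N -> a + (N%:R * delta)^-1 <= alpha ->
  approx_poa tight_game alpha (1 + a)%:E.
Proof.
move=> alpha1 N0 le_alpha; exists (fun=> spreading).
  exact: optimal_spreading.
rewrite welfare_spreading; split.
  exists (fun=> congesting); first exact: approx_nash_congesting.
  by rewrite welfare_congesting inver oner_eq0 invr1 mule1.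
move=> _ [s [sG _] <-].
have s1 : 1 <= welfare tight_game s.
  rewrite welfare_tight // lerDl; exact: load_ge0 sG.
have s0 : 0 < welfare tight_game s by lra.
rewrite inver gt_eqF // -EFinM lee_fin ler_pdivrMr //.
by rewrite ler_peMr // addr_ge0.
Qed.

End TightGame.

(** * Choice of parameters and conclusion *)

Lemma exists_tight_bag (R : realType) (delta alpha eps : R) :
  0 < delta -> 1 <= alpha -> 0 < eps -> eps <= alpha ->
  exists (n m : nat) (G : bag R n m),
    delta_share G delta /\ approx_poa G alpha (alpha + 1 - eps)%:E.
Proof.
move=> delta0 alpha1 eps0 eps_alpha.
(* Any [N] above the first summand gives [N.+1%:R^-1 <= delta], and above the second
   [(N%:R * delta)^-1 <= eps]. *)
pose K := delta^-1 + (eps * delta)^-1.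
have ed0 : 0 < (eps * delta)^-1 by rewrite invr_gt0 mulr_gt0.
have d0 : 0 < delta^-1 by rewrite invr_gt0.
have K0 : 0 < K by rewrite addr_gt0.
have := archi_boundP (ltW K0); set N := Num.bound K => KN.
have NR0 : 0 < N%:R :> R by apply: lt_trans KN.
have N0 : (0 < N)%N by rewrite -(ltr0n R).
have le_delta : N.+1%:R^-1 <= delta.
  rewrite -[leRHS]invrK lef_pV2 ?posrE ?ltr0n // -natr1.
  by move: KN; rewrite /K; lra.
have a0 : 0 <= alpha - eps by lra.
exists N.+1, 2, (tight_game N delta0 a0); split.
  exact: tight_game_delta_share.
have -> : alpha + 1 - eps = 1 + (alpha - eps) by ring.
apply: approx_poa_tight => //.
suff : (N%:R * delta)^-1 <= eps by lra.
rewrite -[leRHS]invrK lef_pV2 ?posrE ?invr_gt0 ?mulr_gt0 //.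
rewrite -ler_pdivrMr // -invfM.
by move: KN; rewrite /K; lra.
Qed.

Theorem theorem4p9 (R : realType) (delta alpha : R)
    (delta_gt0 : 0 < delta) (alpha_ge1 : 1 <= alpha) :
  (forall (n m : nat) (G : bag R n m), delta_share G delta ->
     forall p : \bar R, approx_poa G alpha p -> (p <= (alpha + 1)%:E)%E)
  /\
  (forall eps : R, 0 < eps ->
     exists (n m : nat) (G : bag R n m) (p : \bar R),
       [/\ delta_share G delta,
           approx_poa G alpha p,
           ((alpha + 1 - eps)%:E <= p)%E
         & eps <= alpha -> p = (alpha + 1 - eps)%:E]).
Proof.
split=> [n m G _ p|eps eps0]; first by apply: approx_poa_le; lra.
have [le_eps|lt_eps] := leP eps alpha.
  have [n [m [G [Gd Gp]]]] := exists_tight_bag delta_gt0 alpha_ge1 eps0 le_eps.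
  by exists n, m, G, (alpha + 1 - eps)%:E; split.
(* For [eps > alpha] the demand [alpha - eps] would be negative. The game built for [eps = alpha]
   has price of anarchy 1, which lies above [alpha + 1 - eps]. *)
have alpha_gt0 : 0 < alpha by lra.
have [n [m [G [Gd Gp]]]] :=
  exists_tight_bag delta_gt0 alpha_ge1 alpha_gt0 (lexx alpha).
exists n, m, G, (alpha + 1 - alpha)%:E; split=> //.
by rewrite lee_fin; lra.
Qed.
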